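(* Let $N\ge 1$, let $0<n_1<\cdots<n_N$ be distinct positive integers, and let $a_1,\dots,a_N\in\mathbb{C}$ be not all zero. For $x\in\mathbb{T}$ let $P(x)=\sum_{k=1}^N a_k e^{in_kx}=f(x)+i\widetilde f(x)$, where $f$ and $\widetilde f$ are the real and imaginary parts of $P$, and let $M=-\min_{x\in\mathbb{T}} f(x)$. Then for every real $p>1$, $$M\ \ge\ \frac{\|\widetilde f\|_p^p}{A_p\,\|\widetilde f\|_\infty^{p-1}},\qquad\text{where}\quad A_p=p\int_0^1\frac{t^{p-1}}{\sin(\pi t/2)}\,dt .$$
   Context: $\mathbb{T}=\mathbb{R}/2\pi\mathbb{Z}$ is equipped with normalized Haar measure $dm(x)=dx/(2\pi)$; $\|g\|_p=\left(\int_{\mathbb{T}}|g|^p\,dm\right)^{1/p}$ and $\|g\|_\infty=\sup_{x\in\mathbb{T}}|g(x)|$ for continuous $g$ on $\mathbb{T}$. *)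

(* Defs.v *)
From HB Require Import structures.
From mathcomp Require Export all_boot all_order all_algebra.
From mathcomp Require Export all_classical all_reals all_analysis.
From mathcomp Require Export complex.

Set Implicit Arguments.
Unset Strict Implicit.
Unset Printing Implicit Defensive.
Import Order.TTheory GRing.Theory Num.Theory.

Local Open Scope classical_set_scope.
Local Open Scope complex_scope.
Local Open Scope ring_scope.

(* A function on the circle R/2piZ is represented by its 2pi-periodic lift to
   R, so that its range is the range of the lift. *)

Definition expi {R : realType} (x : R) : R[i] := cos x +i* sin x.

Definition trig_poly {R : realType} {N : nat} (n : 'I_N -> nat)
    (a : 'I_N -> R[i]) (x : R) : R[i] :=
  \sum_(k < N) a k * expi ((n k)%:R * x).

Lemma two_pi_gt0 {R : realType} : 0 < 2 * pi :> R.
Proof. by rewrite mulr_gt0 ?ltr0n ?pi_gt0. Qed.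

(* Normalized Haar measure dx/2pi on the fundamental domain [0, 2pi]; the two
   identified endpoints are a null set. *)
Definition haar {R : realType} : probability (measurableTypeR R) R :=
  uniform_prob (@two_pi_gt0 R).

(* fine loses nothing: the norm is finite for continuous periodic g. *)
Definition Lp_norm {R : realType} (p : R) (g : R -> R) : R :=
  fine ('N[haar]_(p%:E)[EFin \o g])%E.

(* The true supremum, not the essential supremum of Lnorm at +oo. *)
Definition sup_norm {R : realType} (g : R -> R) : R :=
  sup (range (fun x => `|g x|)).

(* The least element of A, or 0 if A has none. *)
Definition minimum {R : realType} (A : set R) : R := xget 0 (A `&` lbound A).

(* The Lebesgue integral covers the integrable singularity at 0 when p < 2, and
   the value of the integrand at 0 itself is immaterial. *)
Definition Aconst {R : realType} (p : R) : R :=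
  p * \int[lebesgue_measure]_(t in `[0, 1]) (t `^ (p - 1) / sin (pi * t / 2)).

(* Main.v *)
Require Import Defs.
From mathcomp Require Import ring lra measurable_realfun.

(** Let [M = - min f], [F = sup |ftilde|] and [m > M], so that [P + m] takes its
    values in the half-strip [x > 0, |y| <= F]. The harmonic measure, seen from
    [x + iy], of the part of the boundary segment [x = 0] lying in [|y| < F s] is
      [u_s = (atan (sin (phi + Y) / sinh X) + atan (sin (phi - Y) / sinh X)) / pi]
    with [phi = pi s / 2], [X = pi x / (2 F)] and [Y = pi y / (2 F)].
    Since [u_s <= 1] and [\int_0^1 u_s ds <= 1 - |y| / F], a bathtub argument gives
    [|y / F|^p <= \int_0^1 p s^(p-1) (1 - u_s) ds]. We average this over the circle.
    The function [u_s] is a convergent series of terms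
    [e^(-(2k+1) X) cos ((2k+1) Y)], each the real part of an exponential of a
    polynomial without constant term in [e^(i theta)] plus a constant, so the mean
    of [u_s] is its value at [P = 0]. There [1 - u_s <= m / (F sin (pi s / 2))],
    which is the integrand of [A_p]; finally [m] tends to [M]. *)

Set Implicit Arguments.
Unset Strict Implicit.
Unset Printing Implicit Defensive.
Import Order.TTheory GRing.Theory Num.Theory.
Import numFieldNormedType.Exports.

Local Open Scope classical_set_scope.
Local Open Scope complex_scope.
Local Open Scope ring_scope.

(** * Calculus *)

(** The mean value theorem for [h - s * g] with [s = 1] and [s = -1]. Later error bounds are passed
    from derivatives to functions through it. *)
Lemma norm_increment_le (R : realType) (g h dg dh : R -> R) (L : R) :
  0 <= L ->
  (forall x, 0 <= x <= L -> is_derive x 1 g (dg x)) ->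
  (forall x, 0 <= x <= L -> is_derive x 1 h (dh x)) ->
  (forall x, 0 <= x <= L -> `|dg x| <= dh x) ->
  `|g L - g 0| <= h L - h 0.
Proof.
move=> L0 Dg Dh le_gh.
have incr (s : R) : `|s| = 1 -> s * (g L - g 0) <= h L - h 0.
  move=> s1.
  have Dk x : 0 <= x <= L ->
      is_derive x 1 (fun x => h x - s * g x) (dh x - s * dg x).
    move=> xL; have ? := Dg x xL; have ? := Dh x xL.
    by apply: is_derive_eq; rewrite ?scaler0 ?addr0 ?add0r.
  have [||c] := @MVT_segment R (fun x => h x - s * g x)
    (fun x => dh x - s * dg x) 0 L L0.
  - by move=> x; rewrite in_itv /= => /andP[x0 xL]; apply: Dk; rewrite !ltW.
  - apply: derivable_within_continuous => x; rewrite in_itv /= => xL.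
    by have := Dk x xL => ?.
  rewrite in_itv /= subr0 => cL E.
  have : 0 <= (dh c - s * dg c) * L.
    rewrite mulr_ge0// subr_ge0 (le_trans _ (le_gh _ cL))//.
    by rewrite (le_trans (ler_norm _))// normrM s1 mul1r.
  rewrite -E; lra.
rewrite ler_norml; have := incr 1 (normr1 _); have := incr (-1) (normrN1 _).
by move=> ? ?; apply/andP; split; lra.
Qed.

(** * Derivative rules for pointwise formulas *)

Section derive_eta.
Context {R : realType}.
Implicit Types (f g : R -> R) (x a b : R).

Lemma der_cst x a : is_derive x 1 (fun=> a) (0 : R).
Proof. exact: is_derive_cst. Qed.

Lemma der_id x : is_derive x 1 (fun y : R => y) (1 : R).
Proof. exact: is_derive_id. Qed.

Lemma der_add f g x a b : is_derive x 1 f a -> is_derive x 1 g b ->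
  is_derive x 1 (fun y => f y + g y) (a + b).
Proof. by move=> ? ?; exact: is_deriveD. Qed.

Lemma der_opp f x a : is_derive x 1 f a ->
  is_derive x 1 (fun y => - f y) (- a).
Proof. by move=> ?; exact: is_deriveN. Qed.

Lemma der_mul f g x a b : is_derive x 1 f a -> is_derive x 1 g b ->
  is_derive x 1 (fun y => f y * g y) (f x * b + g x * a).
Proof. by move=> ? ?; exact: is_deriveM. Qed.

Lemma der_exp f x a n : is_derive x 1 f a ->
  is_derive x 1 (fun y => f y ^+ n) (n%:R * f x ^+ n.-1 * a).
Proof.
move=> ?; rewrite (_ : (fun y => f y ^+ n) = f ^+ n); first exact: is_deriveX.
by apply/funext => y; rewrite exprfctE.
Qed.

Lemma der_inv f x a : f x != 0 -> is_derive x 1 f a ->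
  is_derive x 1 (fun y => (f y)^-1) (- (f x) ^- 2 * a).
Proof. by move=> ? ?; exact: is_deriveV. Qed.

Lemma der_comp f g x a b : is_derive (g x) 1 f a -> is_derive x 1 g b ->
  is_derive x 1 (fun y => f (g y)) (a * b).
Proof. by move=> ? ?; exact: is_derive1_comp. Qed.

Lemma der_sin g x b : is_derive x 1 g b ->
  is_derive x 1 (fun y => sin (g y)) (cos (g x) * b).
Proof. exact: der_comp. Qed.

Lemma der_cos g x b : is_derive x 1 g b ->
  is_derive x 1 (fun y => cos (g y)) (- sin (g x) * b).
Proof. exact: der_comp. Qed.

Lemma der_expR g x b : is_derive x 1 g b ->
  is_derive x 1 (fun y => expR (g y)) (expR (g x) * b).
Proof. exact: der_comp. Qed.

Lemma der_atan g x b : is_derive x 1 g b ->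
  is_derive x 1 (fun y => atan (g y)) ((1 + g x ^+ 2)^-1 * b).
Proof. exact: der_comp. Qed.

End derive_eta.

(** Hypotheses are tried first, so a function with a known derivative counts as a leaf. The
    conditions [f x != 0] of [der_inv] are left as goals unless a hypothesis proves them. *)
Ltac der := repeat first
  [ eassumption | exact: der_cst | exact: der_id | apply: der_add
  | apply: der_opp | apply: der_mul | apply: der_exp | apply: der_inv
  | apply: der_sin | apply: der_cos | apply: der_expR | apply: der_atan ].

Ltac der_eq := eapply is_derive_eq; [der|].

(** * The series of the harmonic measure *)

(** With [z = r e^(i phi)] and [0 <= r < 1], this is a partial sum of [Im log ((1 + z) / (1 - z))],
    and the argument of [(1 + z) / (1 - z)] is [atan (2 r sin phi / (1 - r^2))]. *)
Definition odd_sin_sum (R : realType) (K : nat) (r phi : R) : R :=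
  \sum_(k < K) 2 * r ^+ k.*2.+1 / k.*2.+1%:R * sin (k.*2.+1%:R * phi).

(** The imaginary part of a geometric sum of ratio [z^2], where [z = r e^(i phi)], cleared of its
    denominator [|1 - z^2|^2 = (1 - r^2)^2 + 4 r^2 sin^2 phi]. *)
Lemma odd_sin_geometric (R : realType) (K : nat) (r phi : R) :
  (\sum_(k < K) 2 * r ^+ k.*2 * sin (k.*2.+1%:R * phi)) *
    ((1 - r ^+ 2) ^+ 2 + 4 * r ^+ 2 * sin phi ^+ 2) =
  2 * sin phi * (1 + r ^+ 2) - 2 * r ^+ K.*2 *
    (sin (K.*2.+1%:R * phi) - r ^+ 2 * sin (K.*2.+1%:R * phi - (phi + phi))).
Proof.
elim: K => [|K IH].
  rewrite big_ord0 mul0r double0 mul1r opprD addNKr expr0 sinN; ring.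
rewrite big_ord_recr /= mulrDl IH doubleS.
have -> : K.*2.+3%:R * phi = K.*2.+1%:R * phi + (phi + phi).
  by rewrite -(addn2 K.*2.+1) natrD mulrDl; ring.
rewrite addrK !(sinD, cosD, sinN, cosN) !exprS.
have := cos2Dsin2 phi; set s := sin phi; set c := cos phi => E.
have -> : c * c = 1 - s ^+ 2 by rewrite -E; ring.
set S := sin _; set C := cos _; ring.
Qed.

Lemma is_derive_odd_sin_sum (R : realType) (K : nat) (r phi : R) :
  is_derive r 1 (fun x => odd_sin_sum K x phi)
    (\sum_(k < K) 2 * r ^+ k.*2 * sin (k.*2.+1%:R * phi)).
Proof.
elim: K => [|K IH]; rewrite /odd_sin_sum.
  rewrite big_ord0; under eq_fun do rewrite big_ord0; exact: is_derive_cst.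
rewrite big_ord_recr /=; under eq_fun do rewrite big_ord_recr /=.
apply: is_deriveD.
set a := K.*2.+1%:R; have a0 : a != 0 by rewrite pnatr_eq0.
by der_eq; rewrite /= -/a; field.
Qed.

(* For [r = expR (- b)] this is [atan (sin phi / sinh b)]. *)
Definition atan_sin_sinh (R : realType) (r phi : R) : R :=
  atan (2 * r * sin phi / (1 - r ^+ 2)).

Lemma is_derive_atan_sin_sinh (R : realType) (r phi : R) : 0 <= r < 1 ->
  is_derive r 1 (fun x => atan_sin_sinh x phi)
    (2 * sin phi * (1 + r ^+ 2) /
     ((1 - r ^+ 2) ^+ 2 + 4 * r ^+ 2 * sin phi ^+ 2)).
Proof.
move=> /andP[r0 r1].
have d0 : 1 - r ^+ 2 != 0 by rewrite gt_eqF// subr_gt0 expr_lt1.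
rewrite /atan_sin_sinh; der_eq => //.
have p0 : 0 < (1 - r ^+ 2) ^+ 2 + 4 * r ^+ 2 * sin phi ^+ 2.
  rewrite ltr_pwDl// ?exprn_gt0 ?subr_gt0 ?expr_lt1//.
  by rewrite mulr_ge0 ?sqr_ge0// mulr_ge0 ?sqr_ge0.
have := lt0r_neq0 p0; rewrite /GRing.scale/=.
set s := sin phi => E.
by field; rewrite d0 E.
Qed.

(** Both functions vanish at [r = 0], and their derivatives differ by the tail of the geometric sum,
    at most [4 rho^(2K) / (1 - rho^2)^2]. The bound is uniform in [phi] and in [r <= rho], so the
    series can be averaged term by term. *)
Lemma atan_sin_sinh_series (R : realType) (K : nat) (r rho phi : R) :
  0 <= r <= rho -> rho < 1 ->
  `|atan_sin_sinh r phi - odd_sin_sum K r phi| <=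
  rho ^+ K.*2 * (4 / (1 - rho ^+ 2) ^+ 2).
Proof.
move=> /andP[r0 rrho] rho1; have rho0 : 0 <= rho by rewrite (le_trans r0).
set C := 4 / _; have r1 : r < 1 by rewrite (le_lt_trans rrho).
have D0 : 0 < 1 - rho ^+ 2 by rewrite subr_gt0 expr_lt1.
have C0 : 0 <= C by rewrite divr_ge0// exprn_ge0// ltW.
pose dh (x : R) := rho ^+ K.*2 * C + 0 * x.
pose dg (x : R) := 2 * sin phi * (1 + x ^+ 2) /
     ((1 - x ^+ 2) ^+ 2 + 4 * x ^+ 2 * sin phi ^+ 2) -
   \sum_(k < K) 2 * x ^+ k.*2 * sin (k.*2.+1%:R * phi).
have xrho x : 0 <= x <= r -> 0 <= x <= rho /\ x < 1.
  move=> /andP[-> xr]; rewrite (le_trans xr rrho)//; split => //; exact: le_lt_trans xr _.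
have := @norm_increment_le R (fun x => atan_sin_sinh x phi - odd_sin_sum K x phi)
  (fun x => rho ^+ K.*2 * C * x) dg dh r r0.
have -> : atan_sin_sinh 0 phi - odd_sin_sum K 0 phi = 0.
  rewrite /atan_sin_sinh mulr0 !mul0r atan0 sub0r /odd_sin_sum big1 ?oppr0//.
  by move=> k _; rewrite expr0n/= mulr0 !mul0r.
rewrite mulr0 !subr0 => H; apply: (le_trans (H _ _ _)) => {H}.
- move=> x xr; have [/andP[x0 _] x1] := xrho x xr.
  have := @is_derive_atan_sin_sinh R x phi; rewrite x0 x1 => /(_ isT) ?.
  have := is_derive_odd_sin_sum K x phi => ?.
  exact: is_deriveB.
- move=> x xr; rewrite /dh.
  by der_eq; rewrite /dh; ring.
- move=> x xr; have [/andP[x0 xrho'] x1] := xrho x xr.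
  rewrite /dh /dg mul0r addr0.
  set D := (1 - x ^+ 2) ^+ 2 + _.
  have D1 : (1 - rho ^+ 2) ^+ 2 <= D.
    rewrite /D -[leLHS]addr0 lerD//; last first.
      by rewrite mulr_ge0 ?sqr_ge0// mulr_ge0 ?sqr_ge0.
    rewrite ler_pXn2r// ?nnegrE ?subr_ge0 ?expr_le1//; try exact: ltW.
    by rewrite lerD2l lerN2 ler_pXn2r.
  have D2 : 0 < D by rewrite (lt_le_trans _ D1)// exprn_gt0.
  have E : 2 * sin phi * (1 + x ^+ 2) / D -
      \sum_(k < K) 2 * x ^+ k.*2 * sin (k.*2.+1%:R * phi) =
    2 * x ^+ K.*2 * (sin (K.*2.+1%:R * phi)
       - x ^+ 2 * sin (K.*2.+1%:R * phi - (phi + phi))) / D.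
    apply: (mulIf (lt0r_neq0 D2)); rewrite mulrBl odd_sin_geometric !mulfVK ?gt_eqF//; ring.
  rewrite E normrM normfV (gtr0_norm D2) /C mulrA ler_pM//.
  + by rewrite invr_ge0 ltW.
  + rewrite normrM mulrC [`|2 * _|]ger0_norm ?mulr_ge0 ?exprn_ge0//.
    have -> : rho ^+ K.*2 * 4 = 2 * (2 * rho ^+ K.*2) by ring.
    apply: ler_pM => //; first by rewrite mulr_ge0// exprn_ge0.
      have sin1 (y : R) : `|sin y| <= 1 by rewrite ler_norml sin_geN1 sin_le1.
      rewrite (le_trans (ler_normB _ _))// (natrD _ 1 1) lerD//.
      rewrite normrM (ger0_norm (exprn_ge0 _ x0)) mulr_ile1 ?exprn_ge0//.
      by rewrite expr_le1// ltW.
    by rewrite ler_pM2l// lerXn2r.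
  + by rewrite lef_pV2// posrE// exprn_gt0.
by apply: ler_piMr; [apply: mulr_ge0 => //; exact: exprn_ge0|exact: ltW].
Qed.

(* The left-hand side is [atan (sinh b / sin phi)]. *)
Lemma pihalf_sub_atan_sin_sinh_le (R : realType) (b phi : R) :
  0 < b -> 0 < sin phi ->
  pi / 2 - atan_sin_sinh (expR (- b)) phi <= b / sin phi.
Proof.
move=> b0 s0; set s := sin phi in s0 *.
have s1 : s <= 1 by exact: sin_le1.
(* [G x = atan (sinh x / s)] vanishes at 0, so it suffices to bound its derivative by [1 / s]. *)
pose G (x : R) := atan ((expR x - expR (- x)) / (2 * s)).
have s_neq0 : s != 0 by rewrite gt_eqF.
have -> : pi / 2 - atan_sin_sinh (expR (- b)) phi = G b.
  have E : 2 * expR (- b) * s / (1 - expR (- b) ^+ 2) =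
      ((expR b - expR (- b)) / (2 * s))^-1.
    rewrite expRN; set e := expR b.
    have e1 : 1 < e by rewrite expR_gt1.
    have ? : e != 0 by rewrite gt_eqF// (lt_trans ltr01).
    have ? : e ^+ 2 - 1 != 0 by rewrite gt_eqF// subr_gt0 exprn_egt1.
    by field; do ?[apply/andP; split].
  rewrite /atan_sin_sinh -/s E /G.
  set y := (_ / (2 * s)).
  have y0 : 0 < y.
    rewrite divr_gt0 ?mulr_gt0// subr_gt0 ltr_expR; lra.
  rewrite -[RHS](@tanK R); last first.
    by rewrite in_itv/= atan_gtNpi2 atan_ltpi2.
  rewrite -[LHS](@tanK R) ?atanK; last first.
    have := atan_ltpi2 y^-1.
    have : atan 0 < atan y^-1 by rewrite lt_atan// invr_gt0.
    rewrite atan0 => ? ?.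
    rewrite in_itv/=; apply/andP; split; lra.
  have tan_compl (a : R) : tan (pi / 2 - a) = (tan a)^-1.
    rewrite /tan invf_div sinB cosB sin_pihalf cos_pihalf.
    by rewrite !mul1r !mul0r subr0 add0r.
  by rewrite tan_compl atanK invrK.
pose dG (x : R) := (1 + ((expR x - expR (- x)) / (2 * s)) ^+ 2)^-1 *
  ((expR x + expR (- x)) / (2 * s)).
have := @norm_increment_le R G (fun x => x / s) dG (fun=> s^-1) b (ltW b0).
have -> : G 0 = 0 by rewrite /G oppr0 subrr mul0r atan0.
rewrite mul0r !subr0 => H.
apply: (le_trans (ler_norm _)); apply: H => x /andP[x0 xb].
- by rewrite /G /dG; der_eq; rewrite /GRing.scale/=; congr (_ * _); ring.
- by der_eq; rewrite /GRing.scale/=; ring.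
have e0 := expR_gt0 x; have f0 := expR_gt0 (- x).
have ef : expR x * expR (- x) = 1 by rewrite -expRD subrr expR0.
rewrite /dG; set e := expR x in e0 ef *; set f := expR (- x) in f0 ef *.
set D := 1 + _ ^+ 2; have D0 : 0 < D by rewrite ltr_pwDl// sqr_ge0.
have q0 : 0 < (e + f) / (2 * s) by rewrite divr_gt0 ?addr_gt0 ?mulr_gt0.
rewrite ger0_norm; last by rewrite mulr_ge0 ?(ltW q0)// invr_ge0 ltW.
(* With [C = cosh x] the claim is [s^2 C <= s^2 + C^2 - 1], that is [(C - 1) (C + 1 - s^2) >= 0],
   and [C >= 1 >= s^2]. *)
rewrite ler_pdivrMl// /D.
have -> : (1 + ((e - f) / (2 * s)) ^+ 2) / s =
   (4 * s ^+ 2 + (e - f) ^+ 2) / (2 * s ^+ 2) / (2 * s) by field.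
rewrite ler_pM2r ?invr_gt0 ?mulr_gt0// ler_pdivlMr ?mulr_gt0//.
have E4 : 4 = 4 * (e * f) :> R by rewrite ef mulr1.
have C1 : 2 <= e + f.
  have : 0 <= (e - f) ^+ 2 by exact: sqr_ge0.
  have : (e + f) ^+ 2 = (e - f) ^+ 2 + 4 by rewrite E4; ring.
  nra.
have -> : (e - f) ^+ 2 = (e + f) ^+ 2 - 4 by rewrite E4; ring.
have s21 : s ^+ 2 <= 1 by rewrite expr_le1// ltW.
have s20 := sqr_ge0 s.
nra.
Qed.

(** * Taylor expansion of the complex exponential *)

(** With [c j] the real or imaginary part of [w^j], this is that part of a Taylor polynomial of
    [exp (x w)]. Leaving [c] free makes differentiation a shift of [c]. *)
Definition exp_partial (R : realType) (c : nat -> R) (n : nat) (x : R) : R :=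
  \sum_(j < n) x ^+ j / j`!%:R * c j.

Lemma is_derive_exp_partial (R : realType) (c : nat -> R) n (x : R) :
  is_derive x 1 (exp_partial c n.+1) (exp_partial (fun j => c j.+1) n x).
Proof.
elim: n => [|n IH].
  rewrite /exp_partial big_ord0 (_ : (fun _ => _) = fun=> c 0).
    exact: der_cst.
  by apply/funext => y; rewrite big_ord_recl big_ord0 expr0 fact0 divr1 mul1r addr0.
rewrite {2}/exp_partial big_ord_recr /= -/(exp_partial _ n x).
rewrite (_ : exp_partial c n.+2 = fun y => exp_partial c n.+1 y + y ^+ n.+1 / n.+1`!%:R * c n.+1); last first.
  by apply/funext => y; rewrite /exp_partial big_ord_recr.
have f0 : n`!%:R != 0 :> R by rewrite pnatr_eq0 -lt0n fact_gt0.
have n0 : n.+1%:R != 0 :> R by rewrite pnatr_eq0.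
have nf0 : n.+1`!%:R != 0 :> R by rewrite pnatr_eq0 -lt0n fact_gt0.
apply: der_add => //; der_eq => //; rewrite /GRing.scale/=.
by rewrite factS natrM; field; rewrite f0 nat1r n0.
Qed.

Lemma Re_exprS (R : realType) (w : R[i]) j : complex.Re (w ^+ j.+1) =
  complex.Re w * complex.Re (w ^+ j) - complex.Im w * complex.Im (w ^+ j).
Proof. by rewrite exprS; case: w (w ^+ j) => [a b] [c d]. Qed.

Lemma Im_exprS (R : realType) (w : R[i]) j : complex.Im (w ^+ j.+1) =
  complex.Re w * complex.Im (w ^+ j) + complex.Im w * complex.Re (w ^+ j).
Proof. by rewrite exprS; case: w (w ^+ j) => [a b] [c d]. Qed.

Lemma exp_partialB (R : realType) (c d e : nat -> R) (a b : R) n x :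
  (forall j, c j = a * d j + b * e j) ->
  exp_partial c n x = a * exp_partial d n x + b * exp_partial e n x.
Proof.
move=> E; rewrite /exp_partial !mulr_sumr -big_split; apply: eq_bigr => j _.
by rewrite E /=; ring.
Qed.

(* [Z1 + i Z2 = exp (x w)] and its partial sums satisfy [Z' = w Z] and
   [T_(n+1)' = w T_n], so the error bound integrates from [n] to [n + 1]. *)
Lemma cexp_taylor (R : realType) (w : R[i]) (B L : R) (n : nat) :
  `|complex.Re w| <= B -> `|complex.Im w| <= B -> 0 <= L ->
  `|expR (L * complex.Re w) * cos (L * complex.Im w) -
    exp_partial (fun j => complex.Re (w ^+ j)) n L| <=
  expR (L * B) * ((2 * B * L) ^+ n / n`!%:R).
Proof.
set a := complex.Re w; set b := complex.Im w => aB bB L0.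
have B0 : 0 <= B by rewrite (le_trans _ aB).
set E := expR (L * B); have E0 : 0 <= E by rewrite expR_ge0.
pose S := exp_partial (fun j => complex.Re (w ^+ j)).
pose T := exp_partial (fun j => complex.Im (w ^+ j)).
pose Z1 x := expR (x * a) * cos (x * b).
pose Z2 x := expR (x * a) * sin (x * b).
(* The induction needs both parts and every [x] in [[0, L]]: each derivative mixes the two parts,
   and the bound is integrated from 0. *)
suff H : forall x : R, 0 <= x <= L ->
    `|Z1 x - S n x| <= E * ((2 * B * x) ^+ n / n`!%:R) /\
    `|Z2 x - T n x| <= E * ((2 * B * x) ^+ n / n`!%:R).
  by have /H[] : 0 <= L <= L by rewrite L0 lexx.
elim: n => [|n IH] x /andP[x0 xL].
  rewrite /S /T /exp_partial !big_ord0 !subr0 expr0 fact0 divr1 mulr1.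
  have e1 : expR (x * a) <= E.
    rewrite ler_expR (le_trans (ler_norm _))// normrM ger0_norm// ler_pM//.
  split; rewrite normrM ger0_norm ?expR_ge0// (le_trans _ e1)//.
    by rewrite ler_piMr ?expR_ge0// ler_norml cos_geN1 cos_le1.
  by rewrite ler_piMr ?expR_ge0// ler_norml sin_geN1 sin_le1.
have fn0 : n`!%:R != 0 :> R by rewrite pnatr_eq0 -lt0n fact_gt0.
have n0 : n.+1%:R != 0 :> R by rewrite pnatr_eq0.
(* [h] is the bound at [n + 1], and its derivative is [2 B] times the bound at [n]. The factor [2 B]
   is there because the derivative of each error is a combination of the two previous errors with
   coefficients at most [B]. *)
pose h y : R := E * ((2 * B * y) ^+ n.+1 / n.+1`!%:R).
pose dh y : R := 2 * B * (E * ((2 * B * y) ^+ n / n`!%:R)).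
have nf0 : n.+1`!%:R != 0 :> R by rewrite pnatr_eq0 -lt0n fact_gt0.
have Dh (y : R) : is_derive y 1 h (dh y).
  rewrite /h /dh; der_eq => //; rewrite /GRing.scale/=.
  by rewrite factS natrM; field; rewrite fn0 nat1r n0.
have h0 : h 0 = 0 by rewrite /h mulr0 expr0n/= mul0r mulr0.
have exp0 c : exp_partial c n.+1 0 = c 0 :> R.
  rewrite /exp_partial big_ord_recl big1 => [|i _].
    by rewrite expr0 fact0 divr1 mul1r addr0.
  by rewrite expr0n/= !mul0r.
have inL (y : R) : 0 <= y <= x -> 0 <= y <= L.
  by move=> /andP[-> yx]; exact: le_trans xL.
rewrite -/(h x).
have key (c d u v : R) K : `|c| <= B -> `|d| <= B -> `|u| <= K -> `|v| <= K ->
    `|c * u + d * v| <= 2 * B * K.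
  move=> cB dB uK vK; rewrite (le_trans (ler_normD _ _))// !normrM.
  have -> : 2 * B * K = B * K + B * K by ring.
  by rewrite lerD// ler_pM.
have bBN : `|- b| <= B by rewrite normrN.
split.
- have := @norm_increment_le R (fun y => Z1 y - S n.+1 y) h
    (fun y => a * (Z1 y - S n y) + (- b) * (Z2 y - T n y)) dh x x0.
  rewrite /Z1 /S exp0 !mul0r expR0 cos0 mul1r expr0 subrr h0 !subr0.
  apply => // y /inL yL; last by have [? ?] := IH y yL; exact: key.
  have := is_derive_exp_partial (fun j => complex.Re (w ^+ j)) n y.
  rewrite (@exp_partialB _ _ (fun j => complex.Re (w ^+ j)) (fun j => complex.Im (w ^+ j)) a (- b)) => [Dp|j].
    der_eq; rewrite /GRing.scale/= /Z1 /Z2 -/(S n y) -/(T n y); ring.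
  by rewrite Re_exprS mulNr.
- have := @norm_increment_le R (fun y => Z2 y - T n.+1 y) h
    (fun y => a * (Z2 y - T n y) + b * (Z1 y - S n y)) dh x x0.
  rewrite /Z2 /T exp0 !mul0r sin0 mulr0 expr0 subrr h0 !subr0.
  apply => // y /inL yL; last by have [? ?] := IH y yL; exact: key.
  have := is_derive_exp_partial (fun j => complex.Im (w ^+ j)) n y.
  rewrite (@exp_partialB _ _ (fun j => complex.Im (w ^+ j)) (fun j => complex.Re (w ^+ j)) a b) => [Dp|j].
    der_eq; rewrite /GRing.scale/= /Z1 /Z2 -/(S n y) -/(T n y); ring.
  by rewrite Im_exprS.
Qed.

(** * Means over the circle *)

Section haar_mean.
Context {R : realType}.
Implicit Types (g h F : R -> R) (K c : R).

(** Derivability is the regularity that [der] can establish; together with boundedness it makes a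
    function integrable against the finite measure [haar]. *)
Definition derivable_bounded g :=
  (forall x : R, exists d : R, is_derive x 1 g d) /\ exists K, forall x, `|g x| <= K.

Lemma derivable_bounded_continuous g : derivable_bounded g -> continuous g.
Proof.
move=> [dg _] x; have [d Dg] := dg x.
exact/differentiable_continuous/derivable1_diffP.
Qed.

Lemma derivable_bounded_measurable g : derivable_bounded g ->
  measurable_fun [set: measurableTypeR R] (g : measurableTypeR R -> R).
Proof. by move=> /derivable_bounded_continuous; exact: continuous_measurable_fun. Qed.

Lemma derivable_bounded_integrable g : derivable_bounded g ->
  (@haar R).-integrable [set: measurableTypeR R] (EFin \o g).
Proof.
move=> sg; apply: measurable_bounded_integrable => //.
- have := @probability_setT _ _ _ (@haar R) => /= ->; exact: ltry.
- exact: derivable_bounded_measurable.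
- have [_ [K gK]] := sg; exists K; split; first exact: num_real.
  by move=> y Ky x _ /=; rewrite (le_trans (gK x))// ltW.
Qed.

Lemma derivable_bounded_cst c : derivable_bounded (fun=> c).
Proof. by split=> [x|]; [exists 0; der|exists `|c|]. Qed.

Lemma derivable_boundedD g h : derivable_bounded g -> derivable_bounded h ->
  derivable_bounded (fun x => g x + h x).
Proof.
move=> [dg [K gK]] [dh [L hL]]; split=> [x|].
  by have [d1 ?] := dg x; have [d2 ?] := dh x; exists (d1 + d2); der.
by exists (K + L) => x; rewrite (le_trans (ler_normD _ _))// lerD.
Qed.

Lemma derivable_boundedM g h : derivable_bounded g -> derivable_bounded h ->
  derivable_bounded (fun x => g x * h x).
Proof.
move=> [dg [K gK]] [dh [L hL]]; split=> [x|].
  by have [d1 ?] := dg x; have [d2 ?] := dh x; eexists; der.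
by exists (K * L) => x; rewrite normrM ler_pM.
Qed.

Lemma derivable_boundedZ c g : derivable_bounded g -> derivable_bounded (fun x => c * g x).
Proof. by move=> sg; apply: derivable_boundedM => //; exact: derivable_bounded_cst. Qed.

Lemma derivable_bounded_sum n (g : 'I_n -> R -> R) :
  (forall i, derivable_bounded (g i)) -> derivable_bounded (fun x => \sum_(i < n) g i x).
Proof.
elim: n g => [|n IH] g sg.
  by under eq_fun do rewrite big_ord0; exact: derivable_bounded_cst.
under eq_fun do rewrite big_ord_recr /=.
by apply: derivable_boundedD => //; apply: IH => i; exact: sg.
Qed.

Definition mean g : R := \int[haar]_(x in [set: measurableTypeR R]) g x.

Lemma mean_cst c : mean (fun=> c) = c.
Proof. by rewrite /mean Rintegral_cst//= probability_setT mulr1. Qed.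

Lemma meanD g h : derivable_bounded g -> derivable_bounded h ->
  mean (fun x => g x + h x) = mean g + mean h.
Proof. by move=> ? ?; rewrite /mean RintegralD//; exact: derivable_bounded_integrable. Qed.

Lemma meanZ c g : derivable_bounded g -> mean (fun x => c * g x) = c * mean g.
Proof. by move=> ?; rewrite /mean RintegralZl//; exact: derivable_bounded_integrable. Qed.

Lemma mean_sum n (g : 'I_n -> R -> R) : (forall i, derivable_bounded (g i)) ->
  mean (fun x => \sum_(i < n) g i x) = \sum_(i < n) mean (g i).
Proof.
elim: n g => [|n IH] g sg.
  by under eq_fun do rewrite big_ord0; rewrite mean_cst big_ord0.
under eq_fun do rewrite big_ord_recr /=.
by rewrite meanD ?IH ?big_ord_recr//; apply: derivable_bounded_sum.
Qed.

Lemma mean_le g h : derivable_bounded g -> derivable_bounded h ->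
  (forall x, g x <= h x) -> mean g <= mean h.
Proof. by move=> ? ? gh; apply: le_Rintegral => //; exact: derivable_bounded_integrable. Qed.

Lemma mean_dist g h K : derivable_bounded g -> derivable_bounded h ->
  (forall x, `|g x - h x| <= K) -> `|mean g - mean h| <= K.
Proof.
move=> sg sh ghK; have sK := derivable_bounded_cst K.
have le1 g' h' : derivable_bounded g' -> derivable_bounded h' ->
    (forall x, g' x <= h' x + K) -> mean g' <= mean h' + K.
  move=> ? ? le; rewrite -[K in leRHS]mean_cst -meanD//.
  by apply: mean_le => //; exact: derivable_boundedD.
rewrite ler_norml lerNl opprB !lerBlDl; apply/andP; split.
  apply: le1 => // x.
  by have := ghK x; rewrite distrC => /(le_trans (ler_norm _)); rewrite lerBlDl.
apply: le1 => // x.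
by have := ghK x => /(le_trans (ler_norm _)); rewrite lerBlDl.
Qed.

Lemma mean_derive F g : (forall x : R, is_derive x 1 F (g x)) ->
  derivable_bounded g -> mean g = (F (2 * pi) - F 0) / (2 * pi).
Proof.
move=> DF sg; have [_ [K gK]] := sg.
have sKg := derivable_boundedD sg (derivable_bounded_cst K).
have pi2 := @two_pi_gt0 R.
(* [integral_uniform] is applied to a nonnegative integrand, hence the shift by the bound [K]. *)
suff H : mean (fun x => g x + K) = (F (2 * pi) - F 0) / (2 * pi) + K.
  by move: H; rewrite meanD// ?mean_cst; [move/addIr|exact: derivable_bounded_cst].
rewrite /mean /Rintegral integral_uniform/=; first last.
- by move=> x; rewrite lee_fin -lerBlDr sub0r; have := gK x; rewrite ler_norml => /andP[].
- apply/measurable_EFinP; exact: (derivable_bounded_measurable sKg).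
pose G x := F x + K * x.
have DG (x : R) : is_derive x 1 G (g x + K).
  by have ? := DF x; rewrite /G; der_eq; rewrite /GRing.scale/=; ring.
have cG : continuous G.
  move=> x; exact/differentiable_continuous/derivable1_diffP.
rewrite (@continuous_FTC2 _ (fun x => g x + K) G) => //.
- rewrite /= subr0 /G mulr0 addr0.
  by have := lt0r_neq0 pi2; move: (2 * pi) => T T0; field.
- by apply: continuous_subspaceT; exact: derivable_bounded_continuous.
- split => [x _||]; first by have := DG x => ?.
  + exact/cvg_at_right_filter/cG.
  + exact/cvg_at_left_filter/cG.
- by move=> x _; rewrite derive1E; have := DG x => ?; rewrite derive_val.
Qed.

End haar_mean.

(** * Polynomials in [expi x] and their means *)

Section analytic_trig_poly.
Context {R : realType}.

Lemma expiX (x : R) m : expi x ^+ m = expi (m%:R * x).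
Proof.
elim: m => [|m IH]; first by rewrite expr0 mul0r /expi cos0 sin0.
rewrite exprS IH -nat1r mulrDl mul1r /expi sinD cosD; simpc.
by congr (_ +i* _); rewrite addrC.
Qed.

Lemma Re_horner_expi (q : {poly R[i]}) (x : R) :
  complex.Re q.[expi x] = \sum_(m < size q)
    (complex.Re q`_m * cos (m%:R * x) + - complex.Im q`_m * sin (m%:R * x)).
Proof.
rewrite horner_coef raddf_sum; apply: eq_bigr => m _.
by rewrite expiX; case: q`_m => a b /=; rewrite mulNr.
Qed.

Lemma derivable_bounded_cos (m : nat) : derivable_bounded (fun x : R => cos (m%:R * x)).
Proof.
split=> [x|]; first by eexists; der.
by exists 1 => x; rewrite ler_norml cos_geN1 cos_le1.
Qed.

Lemma derivable_bounded_sin (m : nat) : derivable_bounded (fun x : R => sin (m%:R * x)).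
Proof.
split=> [x|]; first by eexists; der.
by exists 1 => x; rewrite ler_norml sin_geN1 sin_le1.
Qed.

Lemma derivable_bounded_Re_horner (q : {poly R[i]}) :
  derivable_bounded (fun x : R => complex.Re q.[expi x]).
Proof.
under eq_fun do rewrite Re_horner_expi.
apply: derivable_bounded_sum => m; apply: derivable_boundedD; apply: derivable_boundedZ.
  exact: derivable_bounded_cos.
exact: derivable_bounded_sin.
Qed.

Lemma two_pi_natE (m : nat) : m%:R * (2 * pi) = (pi *+ 2) *+ m :> R.
Proof. by rewrite mulr_natl (mulr_natl pi 2). Qed.

Lemma sin_nat_two_pi (m : nat) : sin (m%:R * (2 * pi)) = 0 :> R.
Proof. by rewrite two_pi_natE -[X in sin X]add0r (periodicn (@sinD2pi R)) sin0. Qed.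

Lemma cos_nat_two_pi (m : nat) : cos (m%:R * (2 * pi)) = 1 :> R.
Proof. by rewrite two_pi_natE -[X in cos X]add0r (periodicn (@cosD2pi R)) cos0. Qed.

Lemma mean_cos (m : nat) : mean (fun x : R => cos (m%:R * x)) = (m == 0)%:R.
Proof.
have [->|m0] := eqVneq m 0%N.
  under eq_fun do rewrite mul0r cos0; exact: mean_cst.
have m0' : m%:R != 0 :> R by rewrite pnatr_eq0.
rewrite (@mean_derive _ (fun x => sin (m%:R * x) / m%:R) _ _ (derivable_bounded_cos m)).
  by rewrite sin_nat_two_pi mulr0 sin0 subrr mul0r.
by move=> x; der_eq => //; rewrite /GRing.scale/=; field.
Qed.

Lemma mean_sin (m : nat) : mean (fun x : R => sin (m%:R * x)) = 0.
Proof.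
have [->|m0] := eqVneq m 0%N.
  under eq_fun do rewrite mul0r sin0; exact: mean_cst.
have m0' : m%:R != 0 :> R by rewrite pnatr_eq0.
rewrite (@mean_derive _ (fun x => - cos (m%:R * x) / m%:R) _ _ (derivable_bounded_sin m)).
  by rewrite cos_nat_two_pi mulr0 cos0 subrr mul0r.
by move=> x; der_eq => //; rewrite /GRing.scale/=; field.
Qed.

(** The mean value property at the origin: every nonzero frequency averages to 0. *)
Lemma mean_Re_horner (q : {poly R[i]}) :
  mean (fun x : R => complex.Re q.[expi x]) = complex.Re q`_0.
Proof.
under eq_fun do rewrite Re_horner_expi.
have sc m := derivable_bounded_cos m; have ss m := derivable_bounded_sin m.
rewrite mean_sum => [|m]; last by apply: derivable_boundedD; exact: derivable_boundedZ.
under eq_bigr => m _ do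
  rewrite (meanD (derivable_boundedZ _ (sc m)) (derivable_boundedZ _ (ss m)))
    (meanZ _ (sc m)) (meanZ _ (ss m)) mean_cos mean_sin mulr0 addr0.
have [->|q0] := eqVneq q 0; first by rewrite size_poly0 big_ord0 coef0.
move: q0; rewrite -size_poly_gt0; case: (size q) => // n _.
rewrite big_ord_recl eqxx mulr1 big1 ?addr0// => m _.
by rewrite mulr0.
Qed.

End analytic_trig_poly.

(** * The mean value property for the harmonic measure *)

Section mean_harmonic.
Context {R : realType}.

Lemma le0_of_cvg0 (a c : R) (u : R^nat) : (forall n, c <= a * u n) ->
  u @ \oo --> (0 : R) -> c <= 0.
Proof.
move=> cu u0; have au0 : a * u n @[n --> \oo] --> a * 0.
  by apply: cvgM => //; exact: cvg_cst.
rewrite -(mulr0 a); apply: (@ler_cvg_to _ _ _ _ (fun=> c) _ c _ _ au0).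
  exact: cvg_cst.
by near=> n; exact: cu.
Unshelve. all: by end_near. Qed.

Lemma derivable_bounded_Im_horner (q : {poly R[i]}) :
  derivable_bounded (fun x : R => complex.Im q.[expi x]).
Proof.
(* [Im z = Re (- i z)]. *)
have := derivable_bounded_Re_horner (- 'i *: q); congr derivable_bounded.
by apply/funext => x; rewrite hornerZ; case: q.[_] => a b /=; simpc.
Qed.

Lemma derivable_bounded_expR (g : R -> R) : derivable_bounded g ->
  derivable_bounded (fun x => expR (g x)).
Proof.
move=> [dg [K gK]]; split=> [x|]; first by have [d ?] := dg x; eexists; der.
exists (expR K) => x; rewrite ger0_norm ?expR_ge0// ler_expR.
exact: le_trans (ler_norm _) (gK x).
Qed.

Lemma derivable_bounded_cos_comp (g : R -> R) : derivable_bounded g ->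
  derivable_bounded (fun x => cos (g x)).
Proof.
move=> [dg _]; split=> [x|]; first by have [d ?] := dg x; eexists; der.
by exists 1 => x; rewrite ler_norml cos_geN1 cos_le1.
Qed.

(** The mean value property for [exp (L q)]: its nonempty Taylor sums are polynomials in [expi x]
    with constant term 1, because [q] has none, and they converge uniformly on the circle. *)
Lemma mean_cexp (q : {poly R[i]}) (L : R) : q`_0 = 0 -> 0 <= L ->
  mean (fun x => expR (L * complex.Re q.[expi x]) * cos (L * complex.Im q.[expi x]))
    = 1.
Proof.
move=> q0 L0; have sr := derivable_bounded_Re_horner q.
have si := derivable_bounded_Im_horner q.
set g := fun x => _; have sg : derivable_bounded g.
  apply: derivable_boundedM; first exact/derivable_bounded_expR/derivable_boundedZ.
  exact/derivable_bounded_cos_comp/derivable_boundedZ.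
have [_ [K1 rK]] := sr; have [_ [K2 iK]] := si.
pose B := Num.max K1 K2.
pose p n x := exp_partial (fun j => complex.Re (q.[expi x] ^+ j)) n L.
have sX j : derivable_bounded (fun x : R => complex.Re (q.[expi x] ^+ j)).
  by under eq_fun do rewrite -horner_exp; exact: derivable_bounded_Re_horner.
have sp n : derivable_bounded (p n).
  by apply: derivable_bounded_sum => j; exact: derivable_boundedZ.
(* The index is [n.+1] because the empty sum has mean 0. *)
have mp n : mean (p n.+1) = 1.
  rewrite /p /exp_partial mean_sum => [|j]; last exact: derivable_boundedZ.
  under eq_bigr => j _ do rewrite meanZ//.
  have mX j : mean (fun x => complex.Re (q.[expi x] ^+ j)) = (j == 0)%:R.
    under eq_fun do rewrite -horner_exp.
    rewrite mean_Re_horner -horner_coef0 horner_exp horner_coef0 q0 expr0n.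
    by case: eqP.
  rewrite big_ord_recl mX mulr1 expr0 fact0 divr1 big1 ?addr0// => j _.
  by rewrite mX mulr0.
apply/eqP; rewrite -subr_eq0 -normr_le0; apply/eqP/eqP.
apply: (@le0_of_cvg0 (expR (L * B)) _ (fun n => exp_coeff (2 * B * L) n.+1)) => [n|].
  rewrite -[X in `|_ - X|](mp n); apply: mean_dist => // x.
  have := @cexp_taylor R q.[expi x] B L n.+1; apply => //.
    by rewrite (le_trans (rK x))// le_max lexx.
  by rewrite (le_trans (iK x))// le_max lexx orbT.
have := @cvg_exp_coeff R (2 * B * L); rewrite -(cvg_shiftS (exp_coeff _)).
exact.
Qed.

Lemma derivable_bounded_atan_sin_sinh (X Y : R -> R) :
  derivable_bounded X -> derivable_bounded Y -> (forall x, 0 < X x) ->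
  derivable_bounded (fun x => atan_sin_sinh (expR (- X x)) (Y x)).
Proof.
move=> [dX _] [dY _] X0; split=> [x|].
  have [a ?] := dX x; have [b ?] := dY x; rewrite /atan_sin_sinh.
  eexists; der; rewrite gt_eqF// subr_gt0 expr_lt1 ?expR_ge0//.
  by rewrite expR_lt1 oppr_lt0.
exists (pi / 2) => x; rewrite /atan_sin_sinh; set y := _ / _.
by have := atan_gtNpi2 y; have := atan_ltpi2 y; rewrite ler_norml => /ltW -> /ltW ->.
Qed.

(** The sum-to-product formula separates [phi] from [y]. With [r = expR (- X)] the last factor is
    [Re exp (- (2k+1) (X + i y))]. *)
Lemma odd_sin_sum_sym K (r phi y : R) :
  odd_sin_sum K r (phi + y) + odd_sin_sum K r (phi - y) =
  \sum_(k < K) 4 / k.*2.+1%:R * sin (k.*2.+1%:R * phi) *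
     (r ^+ k.*2.+1 * cos (k.*2.+1%:R * y)).
Proof.
rewrite /odd_sin_sum -big_split; apply: eq_bigr => k _ /=.
by rewrite mulrDr mulrBr sinD sinB; ring.
Qed.

(** Each term of the series involves the real part of [exp (- (2k+1) c (m + q))], whose mean is its
    value at [q = 0]. The margin [delta] keeps [r] at most [expR (- delta) < 1], where the series
    converges uniformly. *)
Lemma mean_atan_sin_sinh (q : {poly R[i]}) (c m delta phi : R) :
  q`_0 = 0 -> 0 <= c -> 0 < delta -> delta <= c * m ->
  (forall x, delta <= c * (m + complex.Re q.[expi x])) ->
  mean (fun x =>
      atan_sin_sinh (expR (- (c * (m + complex.Re q.[expi x]))))
        (phi + c * complex.Im q.[expi x]) +
      atan_sin_sinh (expR (- (c * (m + complex.Re q.[expi x]))))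
        (phi - c * complex.Im q.[expi x])) =
  2 * atan_sin_sinh (expR (- (c * m))) phi.
Proof.
move=> q0 c0 delta0 dm dX.
pose X x := c * (m + complex.Re q.[expi x]).
pose Y x := c * complex.Im q.[expi x].
have sX : derivable_bounded X.
  apply/derivable_boundedZ/derivable_boundedD; first exact: derivable_bounded_cst.
  exact: derivable_bounded_Re_horner.
have sY : derivable_bounded Y by apply/derivable_boundedZ/derivable_bounded_Im_horner.
have sNY : derivable_bounded (fun x => - Y x).
  by under eq_fun do rewrite -mulN1r; exact: derivable_boundedZ.
have sphi := derivable_bounded_cst phi.
have X0 x : 0 < X x by exact: lt_le_trans (dX x).
set g := fun x => _; have sg : derivable_bounded g.
  by apply: derivable_boundedD; apply: derivable_bounded_atan_sin_sinh => //;
    exact: derivable_boundedD.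
pose rho := expR (- delta).
have rho1 : rho < 1 by rewrite expR_lt1 oppr_lt0.
pose C := 4 / (1 - rho ^+ 2) ^+ 2.
pose p K x := odd_sin_sum K (expR (- X x)) (phi + Y x) +
              odd_sin_sum K (expR (- X x)) (phi - Y x).
have gp K x : `|g x - p K x| <= 2 * (rho ^+ K.*2 * C).
  rewrite /g /p opprD addrACA mulr_natl mulr2n.
  rewrite (le_trans (ler_normD _ _))// lerD// atan_sin_sinh_series// expR_ge0 /=
    ler_expR lerN2; exact: dX.
(* [mean_cexp] wants a nonnegative factor [L], so the minus sign goes into [- q]. *)
pose w K x := expR (- (K.*2.+1%:R * (c * m))) *
   (expR (K.*2.+1%:R * c * complex.Re (- q).[expi x]) *
    cos (K.*2.+1%:R * c * complex.Im (- q).[expi x])).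
have wE K x : expR (- X x) ^+ K.*2.+1 * cos (K.*2.+1%:R * Y x) = w K x.
  rewrite /w -expRM_natl mulrA -expRD hornerN !raddfN /= !mulrN cosN mulrA.
  by rewrite /X /Y; congr (expR _ * cos _); ring.
pose b K (k : 'I_K) := 4 / k.*2.+1%:R * sin (k.*2.+1%:R * phi).
have pE K : p K = fun x => \sum_(k < K) b K k * w k x.
  apply/funext => x; rewrite /p odd_sin_sum_sym; apply: eq_bigr => k _.
  by rewrite wE.
have sw k : derivable_bounded (w k).
  apply: derivable_boundedZ; apply: derivable_boundedM.
    exact/derivable_bounded_expR/derivable_boundedZ/derivable_bounded_Re_horner.
  exact/derivable_bounded_cos_comp/derivable_boundedZ/derivable_bounded_Im_horner.
have sp K : derivable_bounded (p K).
  by rewrite pE; apply: derivable_bounded_sum => k; exact: derivable_boundedZ.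
have mp K : mean (p K) = 2 * odd_sin_sum K (expR (- (c * m))) phi.
  rewrite pE mean_sum => [|k]; last exact: derivable_boundedZ.
  have := odd_sin_sum_sym K (expR (- (c * m))) phi 0.
  rewrite addr0 subr0 mulr_natl mulr2n => ->.
  apply: eq_bigr => k _; rewrite meanZ// /w meanZ; last first.
    apply: derivable_boundedM.
      exact/derivable_bounded_expR/derivable_boundedZ/derivable_bounded_Re_horner.
    exact/derivable_bounded_cos_comp/derivable_boundedZ/derivable_bounded_Im_horner.
  rewrite mean_cexp ?coefN ?q0 ?oppr0 ?mulr_ge0// mulr1 mulr0 cos0 mulr1.
  by rewrite /b -expRM_natl mulrN.
apply/eqP; rewrite -subr_eq0 -normr_le0; apply/eqP/eqP.
apply: (@le0_of_cvg0 (4 * C) _ (fun K => (rho ^+ 2) ^+ K)) => [K|].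
  (* One error comes from averaging the truncated series, the other from truncating it at the centre
     [q = 0]. *)
  have -> : 4 * C * (rho ^+ 2) ^+ K = 2 * (rho ^+ K.*2 * C) + 2 * (rho ^+ K.*2 * C).
    by rewrite -exprM mul2n; ring.
  rewrite (le_trans (ler_distD (mean (p K)) _ _))// lerD//; first exact: mean_dist.
  rewrite mp -mulrBr normrM ger0_norm// ler_pM2l// distrC atan_sin_sinh_series//.
  by rewrite expR_ge0 /= ler_expR lerN2.
by apply: cvg_expr; rewrite normrX expr_lt1// ger0_norm// expR_ge0.
Qed.

End mean_harmonic.

(** * The bathtub argument in the half-strip *)

Section antiderivative.
Context {R : realType}.
Implicit Types (F G f g h k : R -> R) (a b : R).

Lemma within_continuousM (A : set R) f g : {within A, continuous f} ->
  {within A, continuous g} -> {within A, continuous (fun x => f x * g x)}.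
Proof. by move=> cf cg x; exact: (@continuousM R (subspace A) f g x (cf x) (cg x)). Qed.

Lemma continuous_affine_comp f c d : continuous f ->
  continuous (fun x => c + d * f x).
Proof.
move=> cf x; apply: (@continuousD _ _ _ (fun=> c) (fun x => d * f x)).
  exact: cst_continuous.
by apply: (@continuousM _ _ (fun=> d) f); [exact: cst_continuous|exact: cf].
Qed.

(** The derivative is asked only inside the interval because the rule for real powers needs [x > 0],
    while the interval may start at 0. *)
Definition antiderivative F g a b :=
  [/\ {within `[a, b], continuous g}, {within `[a, b], continuous F} &
      forall x, a < x < b -> is_derive x 1 F (g x)].

Lemma antiderivative_is_derive F g a b : continuous g ->
  (forall x : R, a <= x <= b -> is_derive x 1 F (g x)) -> antiderivative F g a b.
Proof.
move=> cg DF; split=> [||x /andP[/ltW ax /ltW xb]].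
- exact: continuous_subspaceT.
- apply: derivable_within_continuous => x; rewrite in_itv/= => xab.
  by have ? := DF x xab.
- by apply: DF; rewrite ax xb.
Qed.

Lemma antiderivativeD F g G h a b : antiderivative F g a b ->
  antiderivative G h a b -> antiderivative (fun x => F x + G x) (fun x => g x + h x) a b.
Proof.
move=> [cg cF DF] [ch cG DG]; split => [x|x|x xab].
- by apply: continuousD; [exact: cg|exact: ch].
- by apply: continuousD; [exact: cF|exact: cG].
- by apply: der_add; [exact: DF|exact: DG].
Qed.

Lemma within_continuous_powR (q b : R) : 0 < q -> 0 < b ->
  {within `[0, b], continuous (fun x : R => x `^ q)}.
Proof.
move=> q0 b0; apply/continuous_within_itvP => //.
have c (x : R) : 0 < x -> {for x, continuous (fun x : R => x `^ q)}.
  move=> x0; apply/differentiable_continuous/derivable1_diffP.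
  by apply: derivable_powR; rewrite in_itv/= x0.
split=> [x /[!in_itv]/= /andP[x0 _]||]; first exact: c.
  by rewrite powR0 ?gt_eqF//; exact: powR_cvg0.
by apply/cvg_at_left_filter/c.
Qed.

Lemma antiderivative_powR (p b : R) : 1 < p -> 0 < b ->
  antiderivative (fun x => x `^ p) (fun x => p * x `^ (p - 1)) 0 b.
Proof.
move=> p1 b0; have p0 : 0 < p by rewrite (lt_trans ltr01).
split=> [x||x /andP[x0 _]].
- apply: within_continuousM; first by apply: continuous_subspaceT; exact: cst_continuous.
  by apply: within_continuous_powR => //; rewrite subr_gt0.
- exact: within_continuous_powR.
- exact: is_derive1_powR.
Qed.

Lemma antiderivative_integral_le F g k a b : a < b -> antiderivative F g a b ->
  {within `[a, b], continuous k} -> (forall x, a <= x <= b -> g x <= k x) ->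
  ((F b - F a)%:E <= \int[lebesgue_measure]_(x in `[a, b]) (k x)%:E)%E.
Proof.
move=> ab [cg cF DF] ck gk.
have [_ Fa Fb] := (continuous_within_itvP F ab).1 cF.
rewrite EFinB -(@continuous_FTC2 R g F a b ab) //.
- apply: le_integral => //.
  + by apply: continuous_compact_integrable => //; exact: segment_compact.
  + by apply: continuous_compact_integrable => //; exact: segment_compact.
  + by move=> x /[!inE]/= /[!in_itv]/= xab; rewrite lee_fin gk.
- by split => // x /[!in_itv]/= /DF ?.
- by move=> x /[!in_itv]/= /DF ?; rewrite derive1E derive_val.
Qed.

Lemma continuous_antiderivative g a : continuous g ->
  exists G, forall x : R, a < x -> is_derive x 1 G (g x).
Proof.
move=> cg; exists (fun x => \int[lebesgue_measure]_(t in `[a, x]) g t) => x ax.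
have ig : lebesgue_measure.-integrable `[a, x + 1] (EFin \o g).
  apply: continuous_compact_integrable; first exact: segment_compact.
  exact: continuous_subspaceT.
have xx1 : x < x + 1 by rewrite ltrDl.
have [d e] := @continuous_FTC1_closed R g a x (x + 1) xx1 ig ax (cg x).
by apply: DeriveDef => //; rewrite -derive1E.
Qed.

(* A bathtub argument: since [u <= 1] and [p * s `^ (p - 1)] increases with
   [s], the integral is least when the mass of [1 - u] sits on [0, y]. *)
Lemma bathtub_le (p y : R) (u V : R -> R) : 1 < p -> 0 <= y <= 1 ->
  continuous u -> (forall s : R, 0 <= s <= 1 -> is_derive s 1 V (u s)) ->
  (forall s, 0 <= s <= 1 -> 0 <= u s <= 1) -> V 1 - V 0 <= 1 - y ->
  ((y `^ p)%:E <=
    \int[lebesgue_measure]_(s in `[0%R, 1%R]) (p * s `^ (p - 1) * (1 - u s))%:E)%E.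
Proof.
move=> p1 /andP[y0 y1] cu DV u01 Vy.
have p0 : 0 < p by rewrite (lt_trans ltr01).
pose k s := p * s `^ (p - 1) * (1 - u s).
(* The weight at the threshold [s = y]. *)
pose c := p * y `^ (p - 1).
have c0 : 0 <= c by rewrite mulr_ge0 ?powR_ge0// ltW.
have k0 s : 0 <= s <= 1 -> 0 <= k s.
  move=> /u01/andP[_ us]; rewrite mulr_ge0 ?subr_ge0// mulr_ge0 ?powR_ge0//.
  exact: ltW.
have powR_le (s t : R) : 0 <= s -> s <= t -> p * s `^ (p - 1) <= p * t `^ (p - 1).
  move=> s0 st; rewrite ler_pM2l// ge0_ler_powR ?nnegrE ?subr_ge0 ?(ltW p1)//.
  exact: le_trans st.
have ck01 : {within `[0, 1], continuous k}.
  have [cp _ _] := antiderivative_powR p1 ltr01; apply: within_continuousM => //.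
  apply: continuous_subspaceT => s; under eq_fun do rewrite -mulN1r.
  exact: continuous_affine_comp.
move: y0; rewrite le_eqVlt => /orP[/eqP <-|y0].
  rewrite powR0 ?gt_eqF//; apply: integral_ge0 => s /=.
  by rewrite in_itv/= lee_fin => /k0.
have mk : measurable_fun (`[0, 1] : set R) (EFin \o k).
  apply/measurable_EFinP; exact: subspace_continuous_measurable_fun.
have sub a b : 0 <= a -> b <= 1 -> {within `[a, b], continuous k}.
  move=> a0 b1; apply: continuous_subspaceW ck01.
  by apply: subset_itv; rewrite bnd_simp.
(* Before [y] the weight is at most [c] and [u >= 0], so the integrand is at least the weight minus
   [c * u]. *)
have le1 : ((y `^ p - c * (V y - V 0))%:E <=
    \int[lebesgue_measure]_(s in `[0%R, y]) (k s)%:E)%E.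
  have := @antiderivative_integral_le
    (fun s => s `^ p + - c * V s) (fun s => p * s `^ (p - 1) + - c * u s) k 0 y y0.
  have -> : y `^ p + - c * V y - (0 `^ p + - c * V 0) = y `^ p - c * (V y - V 0).
    by rewrite powR0 ?gt_eqF//; ring.
  apply=> [||s /andP[s0 sy]].
  - apply: antiderivativeD; first exact: antiderivative_powR.
    apply: antiderivative_is_derive => [|s /andP[s0 sy]].
      under eq_fun do rewrite -[_ * _]add0r; exact: continuous_affine_comp.
    have : 0 <= s <= 1 by rewrite s0 (le_trans sy).
    by move=> /DV ?; der_eq; rewrite /GRing.scale/=; ring.
  - exact: sub.
  - rewrite /k mulrBr mulr1 mulNr lerD2l lerN2.
    have /u01/andP[us _] : 0 <= s <= 1 by rewrite s0 (le_trans sy).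
    by rewrite ler_wpM2r// powR_le.
(* After [y] the weight is at least [c] and [1 - u >= 0], so the integrand is at least
   [c * (1 - u)]. *)
have le2 : ((c * (1 - y - (V 1 - V y)))%:E <=
    \int[lebesgue_measure]_(s in `]y, 1%R]) (k s)%:E)%E.
  move: y1; rewrite le_eqVlt => /orP[/eqP ->|y1].
    by rewrite !subrr mulr0 set_itvoc0 integral_set0.
  rewrite integral_itv_obnd_cbnd; last first.
    apply: measurable_funS mk => //; apply: subset_itv; rewrite bnd_simp// ltW//.
  have := @antiderivative_integral_le
    (fun s => c * (s - V s)) (fun s => c * (1 - u s)) k y 1 y1.
  have -> : c * (1 - V 1) - c * (y - V y) = c * (1 - y - (V 1 - V y)) by ring.
  apply=> [||s /andP[s0 sy]].
  - apply: antiderivative_is_derive => [|s /andP[s0 sy]].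
      under eq_fun do rewrite mulrBr -mulNr; exact: continuous_affine_comp.
    have : 0 <= s <= 1 by rewrite (le_trans (ltW y0)).
    by move=> /DV ?; der_eq; rewrite /GRing.scale/=; ring.
  - by apply: sub => //; exact: ltW.
  - have /u01/andP[_ us] : 0 <= s <= 1 by rewrite (le_trans (ltW y0)).
    by rewrite ler_wpM2r ?subr_ge0// powR_le// ltW.
have D01 : [set` `[0, 1]] = [set` `[0, y]] `|` [set` `]y, 1]] :> set R.
  by rewrite -itv_bndbnd_setU ?bnd_simp// ltW.
rewrite D01 ge0_integral_setU -?D01//.
(* The two bounds add up to [y^p + c (1 - y - (V 1 - V 0))]. *)
- apply: le_trans (leeD le1 le2); rewrite -EFinD lee_fin.
  have : 0 <= c * (1 - y - (V 1 - V 0)) by rewrite mulr_ge0// subr_ge0.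
  lra.
- apply/disj_set2P; rewrite -subset0 => s [] /=; rewrite !in_itv/= => /andP[_ sy] /andP[].
  by rewrite ltNge sy.
Qed.

End antiderivative.

(** * Harmonic measure in the half-strip *)

Section half_strip.
Context {R : realType}.
Implicit Types (r y s phi : R).

Lemma atan_sin_sinhN r phi : atan_sin_sinh r (- phi) = - atan_sin_sinh r phi.
Proof. by rewrite /atan_sin_sinh sinN mulrN mulNr atanN. Qed.

Lemma atan_sin_sinh_piB r phi : atan_sin_sinh r (pi - phi) = atan_sin_sinh r phi.
Proof. by rewrite /atan_sin_sinh sinB sinpi cospi mul0r sub0r mulN1r opprK. Qed.

Lemma norm_atan_sin_sinh r phi : `|atan_sin_sinh r phi| <= pi / 2.
Proof.
rewrite /atan_sin_sinh; set z := _ / _.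
by have := atan_gtNpi2 z; have := atan_ltpi2 z; rewrite ler_norml => /ltW -> /ltW ->.
Qed.

Lemma le_atan_sin_sinh r phi psi : 0 <= r < 1 -> sin phi <= sin psi ->
  atan_sin_sinh r phi <= atan_sin_sinh r psi.
Proof.
move=> /andP[r0 r1] le; apply: le_atan; rewrite ler_pM2r.
  by rewrite ler_wpM2l// mulr_ge0.
by rewrite invr_gt0 subr_gt0 expr_lt1.
Qed.

Lemma continuous_atan_sin_sinh r : 0 <= r < 1 -> continuous (atan_sin_sinh r).
Proof.
move=> /andP[r0 r1] x; apply/differentiable_continuous/derivable1_diffP.
suff [d ?] : exists d, is_derive x 1 (atan_sin_sinh r) d by [].
by rewrite /atan_sin_sinh; eexists; der; rewrite gt_eqF// subr_gt0 expr_lt1.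
Qed.

(* The harmonic measure [u_s], with [r = expR (- X)] and [y] in units of [F]. *)
Definition strip_measure r s y : R :=
  (atan_sin_sinh r (pi / 2 * s + pi / 2 * y) +
   atan_sin_sinh r (pi / 2 * s - pi / 2 * y)) / pi.

Lemma continuous_strip_measure r y : 0 <= r < 1 ->
  continuous (fun s => strip_measure r s y).
Proof.
move=> /andP[r0 r1] x; apply/differentiable_continuous/derivable1_diffP.
suff [d ?] : exists d, is_derive x 1 (fun s => strip_measure r s y) d by [].
have d0 : 1 - r ^+ 2 != 0 by rewrite gt_eqF// subr_gt0 expr_lt1.
have pin0 := lt0r_neq0 (pi_gt0 R).
by rewrite /strip_measure /atan_sin_sinh; eexists; der.
Qed.

(** For the upper bound, each arctangent is at most [pi / 2]. For the lower one, the two sines add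
    up to [2 sin (pi s / 2) cos (pi y / 2) >= 0], and the arctangent is odd and increasing. *)
Lemma strip_measure_bounds r s y : 0 <= r < 1 -> 0 <= s <= 1 -> 0 <= y <= 1 ->
  0 <= strip_measure r s y <= 1.
Proof.
move=> r01 /andP[s0 s1] /andP[y0 y1]; have pi0 := pi_gt0 R.
apply/andP; split; last first.
  rewrite ler_pdivrMr// mul1r [leRHS]splitr.
  by apply: lerD; exact: le_trans (ler_norm _) (norm_atan_sin_sinh _ _).
apply: divr_ge0 (ltW pi0); rewrite -lerBlDr sub0r -atan_sin_sinhN.
apply: le_atan_sin_sinh => //; rewrite sinN sinB sinD.
have : 0 <= sin (pi / 2 * s) * cos (pi / 2 * y).
  apply: mulr_ge0.
    by apply: sin_ge0_pi; nra.
  by apply: cos_ge0_pihalf; nra.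
lra.
Qed.

(* With [g] odd and symmetric about 1, the integral of [(g (s + y) + g (s - y)) / 2]
   over [0, 1] is that of [g] over [y, 1]. *)
Lemma strip_measure_antiderivative r y : 0 <= r < 1 -> 0 <= y <= 1 ->
  exists2 V : R -> R, forall s : R, 0 <= s <= 1 ->
    is_derive s 1 V (strip_measure r s y) & V 1 - V 0 <= 1 - y.
Proof.
move=> r01 /andP[y0 y1]; have pi0 := pi_gt0 R; have pin0 := lt0r_neq0 pi0.
pose g s := 2 / pi * atan_sin_sinh r (pi / 2 * s).
have gN s : g (- s) = - g s by rewrite /g mulrN atan_sin_sinhN mulrN.
have gC s : g (1 - s) = g (1 + s).
  rewrite /g -[in RHS]atan_sin_sinh_piB; congr (_ * atan_sin_sinh _ _).
  by have E (c : R) : c / 2 * (1 - s) = c - c / 2 * (1 + s) by field.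
have g1 s : `|g s| <= 1.
  rewrite normrM ger0_norm ?divr_ge0 ?(ltW pi0)//.
  rewrite -ler_pdivlMl ?divr_gt0// mulr1 invf_div; exact: norm_atan_sin_sinh.
have cg : continuous g.
  rewrite /g; under eq_fun do rewrite -[_ * atan_sin_sinh _ _]add0r.
  apply: continuous_affine_comp => x.
  apply: (@continuous_comp _ _ _ ( *%R (pi / 2)) (atan_sin_sinh r)).
    exact: mulrl_continuous.
  exact: continuous_atan_sin_sinh.
(* Every argument of [S] below is at least -1, so the base point -3 lies safely to the left. *)
have [S DS] := continuous_antiderivative (-3) cg.
have DSaff (c d s : R) : -3 < c + d * s ->
    is_derive s 1 (fun s => S (c + d * s)) (g (c + d * s) * d).
  move=> lt3; apply: der_comp; first exact: DS.
  by der_eq; rewrite /GRing.scale/=; ring.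
have zero_increment (G dG : R -> R) (L : R) : 0 <= L ->
    (forall s : R, 0 <= s <= L -> is_derive s 1 G (dG s)) ->
    (forall s, 0 <= s <= L -> dG s = 0) -> G L = G 0.
  move=> L0 DG dG0; apply/eqP; rewrite -subr_eq0 -normr_le0.
  have := @norm_increment_le R G (fun=> 0) dG (fun=> 0) L L0 DG.
  rewrite subrr; apply => s sL.
  by rewrite dG0// normr0.
(* [g] is odd, so [S] is even; [g] is symmetric about 1, so [S - S 1] is odd about 1. *)
have Seven : S y = S (- y).
  have := @zero_increment (fun s => S (0 + 1 * s) - S (0 + (-1) * s))
    (fun s => g (0 + 1 * s) * 1 - g (0 + (-1) * s) * (-1)) y y0.
  rewrite !mulr0 addr0 subrr !add0r mul1r mulN1r => H.
  apply/eqP; rewrite -subr_eq0; apply/eqP; apply: H => s /andP[s0 sy].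
    by apply: der_add; [|apply: der_opp]; apply: DSaff; lra.
  by rewrite !add0r mul1r mulN1r gN; ring.
have Srefl : S (1 + y) + S (1 - y) = S 1 + S 1.
  have := @zero_increment (fun s => S (1 + 1 * s) + S (1 + (-1) * s))
    (fun s => g (1 + 1 * s) * 1 + g (1 + (-1) * s) * (-1)) y y0.
  rewrite !mulr0 !addr0 mul1r mulN1r; apply => s /andP[s0 sy].
    by apply: der_add; apply: DSaff; lra.
  by rewrite mul1r mulN1r gC; ring.
exists (fun s => 2^-1 * (S (y + 1 * s) + S (- y + 1 * s))).
  move=> s /andP[s0 s1].
  have D1 : is_derive s 1 (fun s => S (y + 1 * s)) (g (y + 1 * s) * 1).
    by apply: DSaff; lra.
  have D2 : is_derive s 1 (fun s => S (- y + 1 * s)) (g (- y + 1 * s) * 1).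
    by apply: DSaff; lra.
  der_eq; rewrite /GRing.scale/= /g /strip_measure !mul1r !mulr1.
  rewrite !mulr0 addr0.
  rewrite [y + s]addrC [- y + s]addrC (mulrDr (pi / 2)) (mulrBr (pi / 2)).
  move: (atan_sin_sinh _ (_ + _)) (atan_sin_sinh _ (_ - _)) => a b.
  by move: (pi) pin0 => c c0; field.
rewrite mulr1 !mulr0 !addr0 -Seven [y + 1]addrC [- y + 1]addrC.
(* By these symmetries [V 1 - V 0 = S 1 - S y], and [|g| <= 1]. *)
suff : S 1 - S y <= 1 - y by have := Srefl; lra.
have := @norm_increment_le R (fun s => S (y + 1 * s)) (fun s => s)
  (fun s => g (y + 1 * s) * 1) (fun=> 1) (1 - y).
rewrite subr_ge0 mulr0 addr0 mul1r subrKC subr0 => H.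
apply: le_trans (ler_norm _) _; apply: H => // s /andP[s0 sy].
- by apply: DSaff; lra.
- by rewrite mulr1.
Qed.

Lemma norm_powR_le_strip (p r y : R) : 1 < p -> 0 <= r < 1 -> `|y| <= 1 ->
  ((`|y| `^ p)%:E <= \int[lebesgue_measure]_(s in `[0%R, 1%R])
     (p * s `^ (p - 1) * (1 - strip_measure r s y))%:E)%E.
Proof.
move=> p1 r01 y1.
(* Changing the sign of [y] only swaps the two terms of [strip_measure]. *)
have -> : (fun s => (p * s `^ (p - 1) * (1 - strip_measure r s y))%:E) =
    (fun s => (p * s `^ (p - 1) * (1 - strip_measure r s `|y|))%:E).
  apply/funext => s; congr (_ * (1 - _))%:E.
  have [y0|y0] := leP 0 y; first by rewrite ger0_norm.
  by rewrite ltr0_norm// /strip_measure mulrN opprK addrC.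
have yab : 0 <= `|y| <= 1 by rewrite normr_ge0.
have [V DV Vy] := strip_measure_antiderivative r01 yab.
apply: (bathtub_le p1 yab _ DV) => // [|s s01]; last exact: strip_measure_bounds.
exact: continuous_strip_measure.
Qed.

End half_strip.

(** * The inequality *)

Section main_inequality.
Context {R : realType}.

(** Joint measurability, for Tonelli's theorem. The factor [2 r / (1 - r^2)] depends on [z.1] alone
    and is continuous in it because [X > 0]. *)
Lemma measurable_atan_sin_sinh (X Y : R -> R) (c : R) :
  derivable_bounded X -> derivable_bounded Y -> (forall x, 0 < X x) ->
  measurable_fun [set: measurableTypeR R * measurableTypeR R]
    (fun z => atan_sin_sinh (expR (- X z.1)) (c * z.2 + Y z.1)).
Proof.
move=> sX sY X0.
pose G x := 2 * expR (- X x) / (1 - expR (- X x) ^+ 2).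
have mG : measurable_fun [set: R] G.
  apply: continuous_measurable_fun => x.
  apply/differentiable_continuous/derivable1_diffP.
  have [dX _] := sX; have [a ?] := dX x.
  suff [d ?] : exists d, is_derive x 1 G d by [].
  rewrite /G; eexists; der; rewrite gt_eqF// subr_gt0 expr_lt1 ?expR_ge0//.
  by rewrite expR_lt1 oppr_lt0.
have matan : measurable_fun [set: R] (@atan R).
  by apply: continuous_measurable_fun; exact: continuous_atan.
have msin : measurable_fun [set: R] (@sin R).
  by apply: continuous_measurable_fun; exact: continuous_sin.
have m1 : measurable_fun [set: measurableTypeR R * measurableTypeR R]
    (fun z => c * z.2 + Y z.1).
  apply: measurable_funD.
    apply: measurable_funM => //; exact: measurable_snd.
  by apply: (measurableT_comp (derivable_bounded_measurable sY)); exact: measurable_fst.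
rewrite (_ : (fun z => _) =
  fun z : measurableTypeR R * measurableTypeR R =>
    atan (G z.1 * sin (c * z.2 + Y z.1))); last first.
  apply/funext => z; rewrite /atan_sin_sinh /G; congr atan.
  by rewrite mulrAC.
apply: (measurableT_comp matan); apply: measurable_funM.
  by apply: (measurableT_comp mG); exact: measurable_fst.
exact: (measurableT_comp msin m1).
Qed.

(** Turns the integral over [[0, 1]] into one over the whole line, so that Tonelli's theorem applies
    to a product of two probability measures. *)
Lemma integral_uniform01 (h : R -> \bar R) :
  measurable_fun [set: R] h -> (forall s, 0 <= h s)%E ->
  (\int[uniform_prob (@ltr01 R)]_s h s =
   \int[lebesgue_measure]_(s in `[0%R, 1%R]) h s)%E.
Proof.
by move=> mh h0; rewrite integral_uniform// subr0 invr1 mul1e.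
Qed.

(** [norm_powR_le_strip] is averaged over the circle, and after Tonelli the harmonic measure is
    evaluated at the centre. The strict inequality [M < m] provides the margin [delta]. The bound is
    between extended reals, so the right-hand integral may a priori be infinite. *)
Lemma integral_norm_powR_le (q : {poly R[i]}) (F m M p : R) :
  q`_0 = 0 -> 0 < F -> 0 <= M -> M < m -> 1 < p ->
  (forall x, - M <= complex.Re q.[expi x]) ->
  (forall x, `|complex.Im q.[expi x]| <= F) ->
  (\int[haar]_x (`|complex.Im q.[expi x] / F| `^ p)%:E <=
   (p * m / F)%:E * \int[lebesgue_measure]_(s in `[0%R, 1%R])
     (s `^ (p - 1) / sin (pi * s / 2))%:E)%E.
Proof.
move=> q0 F0 M0 Mm p1 geM leF.
have p0 : 0 < p by rewrite (lt_trans ltr01).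
have pi0 := pi_gt0 R.
pose f x := complex.Re q.[expi x]; pose v x := complex.Im q.[expi x].
have sf : derivable_bounded f by exact: derivable_bounded_Re_horner.
have sv : derivable_bounded v by exact: derivable_bounded_Im_horner.
(* This scaling sends the height [F] to [pi / 2]. *)
pose c := pi / 2 / F.
have c0 : 0 < c by rewrite !divr_gt0.
pose X x := c * (m + f x).
have sX : derivable_bounded X.
  by apply/derivable_boundedZ/derivable_boundedD => //; exact: derivable_bounded_cst.
pose delta := c * (m - M).
have d0 : 0 < delta by rewrite mulr_gt0// subr_gt0.
have dX x : delta <= X x.
  by rewrite ler_pM2l// lerD2l; exact: geM.
have X0 x : 0 < X x by exact: lt_le_trans (dX x).
have r01 x : 0 <= expR (- X x) < 1 by rewrite expR_ge0 expR_lt1 oppr_lt0 X0.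
have m0 : 0 < m by rewrite (le_lt_trans M0).
pose u x s := strip_measure (expR (- X x)) s (v x / F).
have uE x s : u x s = pi^-1 * (atan_sin_sinh (expR (- X x)) (pi / 2 * s + c * v x) +
    atan_sin_sinh (expR (- X x)) (pi / 2 * s + - (c * v x))).
  by rewrite /u /strip_measure mulrC (_ : pi / 2 * (v x / F) = c * v x)// /c; ring.
have u1 x s : u x s <= 1.
  rewrite /u /strip_measure ler_pdivrMr// mul1r [leRHS]splitr.
  by apply: lerD; exact: le_trans (ler_norm _) (norm_atan_sin_sinh _ _).
have sYN : derivable_bounded (fun x => - (c * v x)).
  by under eq_fun do rewrite -mulNr; exact: derivable_boundedZ.
have su s : derivable_bounded (u^~ s).
  under eq_fun do rewrite uE; apply/derivable_boundedZ/derivable_boundedD;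
  apply: derivable_bounded_atan_sin_sinh => //; apply: derivable_boundedD => //;
  try exact: derivable_bounded_cst.
  exact: derivable_boundedZ.
pose w s := p * s `^ (p - 1).
have w0 s : 0 <= w s by rewrite mulr_ge0 ?powR_ge0// ltW.
have mw : measurable_fun [set: R] w.
  by apply: measurable_funM => //; exact: measurable_powR.
pose k (z : measurableTypeR R * measurableTypeR R) := w z.2 * (1 - u z.1 z.2).
have k0 z : (0 <= (k z)%:E)%E by rewrite lee_fin mulr_ge0// subr_ge0.
have mk : measurable_fun [set: measurableTypeR R * measurableTypeR R] (EFin \o k).
  apply/measurable_EFinP; apply: measurable_funM.
    by apply: (measurableT_comp mw); exact: measurable_snd.
  apply: measurable_funB => //.
  under eq_fun do rewrite uE; apply: measurable_funM => //.
  apply: measurable_funD; last exact: (measurable_atan_sin_sinh _ sX sYN X0).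
  exact: (measurable_atan_sin_sinh _ sX (derivable_boundedZ c sv) X0).
have mks x : measurable_fun [set: measurableTypeR R] (fun s => (k (x, s))%:E).
  exact: (measurable_fun_pair2 x mk).
have mean_u s : mean (u^~ s) = 2 / pi * atan_sin_sinh (expR (- (c * m))) (pi / 2 * s).
  under eq_fun do rewrite uE; rewrite meanZ; last first.
    apply: derivable_boundedD; apply: derivable_bounded_atan_sin_sinh => //;
    apply: derivable_boundedD => //; try exact: derivable_bounded_cst.
    exact: derivable_boundedZ.
  rewrite (mean_atan_sin_sinh _ q0 (ltW c0) d0)//; first by ring.
  by rewrite ler_pM2l// gerBl.
have mean_k s : (\int[haar]_x (k (x, s))%:E =
    (w s * (1 - 2 / pi * atan_sin_sinh (expR (- (c * m))) (pi / 2 * s)))%:E)%E.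
  rewrite -mean_u.
  have s1u : derivable_bounded (fun x => 1 + -1 * u x s).
    by apply: derivable_boundedD; [exact: derivable_bounded_cst|exact: derivable_boundedZ].
  have -> : 1 - mean (u^~ s) = mean (fun x => 1 + -1 * u x s).
    rewrite meanD ?meanZ ?mean_cst ?mulN1r//; first exact: derivable_bounded_cst.
    exact: derivable_boundedZ.
  rewrite -meanZ// /mean /Rintegral fineK.
    by apply: eq_integral => x _; rewrite /k/= mulN1r.
  apply: integrable_fin_num => //; apply: derivable_bounded_integrable.
  exact: derivable_boundedZ.
pose A s := s `^ (p - 1) / sin (pi * s / 2).
have sin0 (s : R) : 0 <= s <= 1 -> 0 <= sin (pi * s / 2).
  move=> /andP[s0 s1]; apply: sin_ge0_pi.
  by have := ler_wpM2l (ltW pi0) s1; have := mulr_ge0 (ltW pi0) s0; lra.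
have mA : measurable_fun (`[0, 1] : set R) A.
  (* The inverse is written as a power with exponent -1, which is measurable; the two agree because
     the sine is nonnegative on [[0, 1]]. *)
  apply: (@eq_measurable_fun _ _ _ _ _ (fun s => s `^ (p - 1) * (sin (pi * s / 2)) `^ (-1))).
    by move=> s; rewrite inE/= in_itv/= => /sin0 ?; rewrite powR_inv1.
  apply: measurable_funTS; apply: measurable_funM; first exact: measurable_powR.
  apply: (measurableT_comp (measurable_powR (-1))).
  apply: continuous_measurable_fun => s.
  apply/differentiable_continuous/derivable1_diffP.
  suff [d ?] : exists d, is_derive s 1 (fun s => sin (pi * s / 2)) d by [].
  by eexists; der.
have A0 (s : R) : 0 <= s <= 1 -> 0 <= A s.
  by move=> s01; rewrite mulr_ge0 ?powR_ge0// invr_ge0 sin0.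
apply: (@le_trans _ _ (\int[haar]_x \int[uniform_prob (@ltr01 R)]_s (k (x, s))%:E)%E).
  apply: ge0_le_integral => //.
  - apply/measurable_EFinP; apply: (measurableT_comp (measurable_powR p)).
    have sy : derivable_bounded (fun x => v x / F).
      by under eq_fun do rewrite mulrC; exact: derivable_boundedZ.
    exact: (measurableT_comp (@normr_measurable R setT) (derivable_bounded_measurable sy)).
  - exact: (measurable_fun_fubini_tonelli_F (m2:=uniform_prob (@ltr01 R)) (EFin \o k) mk k0).
  - move=> x _; rewrite integral_uniform01//; last exact: mks.
    have yx : `|v x / F| <= 1.
      by rewrite normrM normfV (gtr0_norm F0) ler_pdivrMr// mul1r leF.
    have := norm_powR_le_strip p1 (r01 x) yx; rewrite -/(v x).
    rewrite (_ : (fun s => (p * s `^ (p - 1) * _)%:E) = fun s => (k (x, s))%:E)//.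
have swap : (\int[haar]_x \int[uniform_prob (@ltr01 R)]_s (k (x, s))%:E <=
    \int[uniform_prob (@ltr01 R)]_s \int[haar]_x (k (x, s))%:E)%E.
  rewrite le_eqVlt; apply/orP; left; apply/eqP.
  exact: (fubini_tonelli (EFin \o k) mk k0).
apply: (le_trans swap).
under eq_integral => s _ do rewrite mean_k.
have w1 s : 0 <= (w s * (1 - 2 / pi * atan_sin_sinh (expR (- (c * m))) (pi / 2 * s))).
  rewrite mulr_ge0// subr_ge0 -ler_pdivlMl ?divr_gt0// mulr1 invf_div.
  exact: le_trans (ler_norm _) (norm_atan_sin_sinh _ _).
have mw1 : measurable_fun [set: R]
   (fun s => (w s * (1 - 2 / pi * atan_sin_sinh (expR (- (c * m))) (pi / 2 * s)))%:E).
  under eq_fun do rewrite -mean_k.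
  exact: (measurable_fun_fubini_tonelli_G (m1:=haar) (EFin \o k) mk k0).
rewrite integral_uniform01// -ge0_integralZl_EFin//; first last.
- by rewrite !mulr_ge0 ?invr_ge0 ?ltW.
- exact/measurable_EFinP.
apply: ge0_le_integral => //.
- by move=> s _; rewrite lee_fin w1.
- exact: measurable_funTS.
- by apply: emeasurable_funM => //; exact/measurable_EFinP.
(* At [s = 0] the sine vanishes, but both sides are 0 because [p - 1] is not 0. *)
move=> s; rewrite /= in_itv/= => /andP[]; rewrite le_eqVlt => /orP[/eqP <- _|s0 s1].
  by rewrite -EFinM lee_fin /w powR0 ?mulr0 ?mul0r ?mulr0// subr_eq0 gt_eqF.
rewrite -EFinM lee_fin /w /A.
have sin_gt : 0 < sin (pi / 2 * s) by apply: sin_gt0_pi; nra.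
have -> : pi * s / 2 = pi / 2 * s by ring.
(* As [c = pi / (2 F)], multiplying this by [2 / pi] bounds [1 - u_s] at the centre by
   [m / (F sin (pi s / 2))]. *)
have := pihalf_sub_atan_sin_sinh_le (mulr_gt0 c0 m0) sin_gt.
set h := atan_sin_sinh _ _; set S := sin _; set P := s `^ _ => H.
have P0 : 0 <= P by rewrite powR_ge0.
rewrite -/S in sin_gt; clearbody S.
have -> : 1 - 2 / pi * h = 2 / pi * (pi / 2 - h).
  by move: (pi) (lt0r_neq0 pi0) => t t0; field.
have -> : p * m / F * (P / S) = p * P * (2 / pi * (c * m / S)).
  rewrite /c; move: (pi) (lt0r_neq0 pi0) (lt0r_neq0 F0) (lt0r_neq0 sin_gt).
  by move=> t t0 F1 S1; field; rewrite S1 F1 t0.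
by rewrite ler_wpM2l ?mulr_ge0 ?(ltW p0)// ler_pM2l// divr_gt0.
Qed.

End main_inequality.

(** * From trigonometric polynomials to the theorem *)

Lemma trig_polyE (R : realType) (N : nat) (n : 'I_N -> nat) (a : 'I_N -> R[i])
    (x : R) :
  trig_poly n a x = (\sum_(k < N) a k *: 'X^(n k)).[expi x].
Proof.
rewrite /trig_poly horner_sum; apply: eq_bigr => k _.
by rewrite hornerZ hornerXn expiX.
Qed.

Lemma expi_periodic (R : realType) (x : R) (k : int) :
  expi (x + k%:~R * (2 * pi)) = expi x.
Proof.
suff H (y : R) (j : nat) : expi (y + j%:R * (2 * pi)) = expi y.
  case: k => j; first exact: H.
  by rewrite -[LHS](H _ j.+1) NegzE mulrNz mulNr subrK.
rewrite /expi two_pi_natE.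
by rewrite (periodicn (@cosD2pi R)) (periodicn (@sinD2pi R)).
Qed.

Lemma expi_fundamental (R : realType) (x : R) :
  exists2 y : R, 0 <= y <= 2 * pi & expi y = expi x.
Proof.
have T0 := @two_pi_gt0 R; pose k := Num.floor (x / (2 * pi)).
exists (x + (- k)%:~R * (2 * pi)); last exact: expi_periodic.
have := floor_le (x / (2 * pi)); have := floorD1_gt (x / (2 * pi)).
rewrite -/k ler_pdivlMr// ltr_pdivrMr// intrD mulrDl mul1r mulrNz mulNr.
by move=> ? ?; apply/andP; split; lra.
Qed.

(** The extreme value theorem on [[0, 2 pi]], carried to the line by periodicity. The element chosen
    by [xget] in [minimum] is then identified by antisymmetry. *)
Lemma minimum_attained (R : realType) (q : {poly R[i]}) :
  let f := fun x : R => complex.Re q.[expi x] in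
  exists2 x0, minimum (range f) = f x0 & forall x, f x0 <= f x.
Proof.
move=> f; have cf : continuous f.
  exact: derivable_bounded_continuous (derivable_bounded_Re_horner q).
have [c _ minc] := EVT_min (ltW (@two_pi_gt0 R)) (continuous_subspaceT cf).
have fc x : f c <= f x.
  have [y y02 e] := expi_fundamental x.
  by rewrite [leRHS]/f -e; apply: minc; rewrite in_itv.
exists c => //; rewrite /minimum.
have [] : (range f `&` lbound (range f)) (xget 0 (range f `&` lbound (range f))).
  apply: (@xgetI _ _ _ (f c)); split; first by exists c.
  by move=> _ [x _ <-]; exact: fc.
set z := xget _ _ => -[x _ <-] lbz; apply/eqP; rewrite eq_le fc andbT.
by apply: lbz; exists c.
Qed.

Lemma derivable_bounded_le_sup_norm (R : realType) (g : R -> R) (x : R) :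
  derivable_bounded g -> `|g x| <= sup_norm g.
Proof.
move=> [_ [K gK]]; apply: ub_le_sup; last by exists x.
by exists K => _ [y _ <-].
Qed.

Lemma Lp_norm_powR (R : realType) (p : R) (g : R -> R) : 0 < p ->
  Lp_norm p g `^ p = fine (\int[haar]_x (`|g x| `^ p)%:E)%E.
Proof.
by move=> p0; rewrite /Lp_norm -fine_poweR poweR_Lnorm ?gt_eqF.
Qed.

Theorem corollary1 (R : realType) (N : nat) (n : 'I_N -> nat)
    (a : 'I_N -> R[i])
    (N_ge1 : (1 <= N)%N)
    (n_gt0 : forall k : 'I_N, (0 < n k)%N)
    (n_incr : forall j k : 'I_N, (j < k)%N -> (n j < n k)%N)
    (a_neq0 : exists k : 'I_N, a k != 0) :
  let f : R -> R := fun x => complex.Re (trig_poly n a x) in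
  let ftilde : R -> R := fun x => complex.Im (trig_poly n a x) in
  let M : R := - minimum (range f) in
  forall p : R, 1 < p ->
    M >= Lp_norm p ftilde `^ p / (Aconst p * sup_norm ftilde `^ (p - 1)).
Proof.
move=> f ftilde M p p1; have p0 : 0 < p by rewrite (lt_trans ltr01).
pose q : {poly R[i]} := \sum_(k < N) a k *: 'X^(n k).
have fE : f = fun x => complex.Re q.[expi x].
  by apply/funext => x; rewrite /f trig_polyE.
have vE : ftilde = fun x => complex.Im q.[expi x].
  by apply/funext => x; rewrite /ftilde trig_polyE.
have q0 : q`_0 = 0.
  rewrite coef_sum big1// => k _; rewrite coefZ coefXn.
  by rewrite eq_sym gtn_eqF ?mulr0.
have [x0 minE minP] := minimum_attained q.
have ME : M = - complex.Re q.[expi x0] by rewrite /M fE minE.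
(* The constant coefficient of [q] is 0, so [f] has mean 0 and its minimum is at most 0. *)
have M0 : 0 <= M.
  rewrite ME oppr_ge0 -[leLHS](mean_cst (R := R)).
  rewrite (_ : 0 = mean (fun x : R => complex.Re q.[expi x])); last first.
    by rewrite mean_Re_horner q0.
  apply: mean_le => //; first exact: derivable_bounded_cst.
  exact: derivable_bounded_Re_horner.
have sv : derivable_bounded ftilde by rewrite vE; exact: derivable_bounded_Im_horner.
pose F := sup_norm ftilde.
have vF x : `|ftilde x| <= F by exact: derivable_bounded_le_sup_norm.
have : 0 <= F by exact: le_trans (vF 0).
(* If [sup_norm ftilde] is 0, the bound is a quotient by 0, hence 0. *)
rewrite le_eqVlt => /orP[/eqP F0|F0].
  by rewrite -/F -F0 powR0 ?mulr0 ?invr0 ?mulr0// subr_eq0 gt_eqF.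
pose I := (\int[lebesgue_measure]_(s in `[0%R, 1%R])
     (s `^ (p - 1) / sin (pi * s / 2))%:E)%E.
have I0 : (0 <= I)%E.
  apply: integral_ge0 => s /=; rewrite in_itv/= => /andP[s0 s1].
  rewrite lee_fin mulr_ge0 ?powR_ge0// invr_ge0; apply: sin_ge0_pi.
  have := ler_wpM2l (ltW (pi_gt0 R)) s1.
  by have := mulr_ge0 (ltW (pi_gt0 R)) s0; lra.
have AE : Aconst p = p * fine I by [].
have A0 : 0 <= Aconst p by rewrite AE mulr_ge0 ?fine_ge0// ltW.
(* An infinite integral would make [Aconst p], hence the bound, 0. *)
have [Ioo|Ifin] := eqVneq I +oo%E.
  by rewrite AE Ioo /= mulr0 mul0r invr0 mulr0.
have IE : I = (fine I)%:E by rewrite fineK// ge0_fin_numE// ltey.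
(* A zero [Aconst p] likewise makes the bound 0. *)
have [->|A_neq0] := eqVneq (Aconst p) 0; first by rewrite mul0r invr0 mulr0.
have Agt0 : 0 < Aconst p by rewrite lt0r A_neq0.
(* The half-strip argument needs a translation [m] strictly larger than [M]: take [m = M + e] with
   [e > 0] arbitrary. *)
apply/ler_addgt0Pr => e e0.
rewrite ler_pdivrMr; last exact: mulr_gt0 Agt0 (powR_gt0 _ F0).
have := @integral_norm_powR_le R q F (M + e) M p q0 F0 M0.
rewrite ltrDl -/I IE -EFinM => /(_ e0 p1) H.
set J := (\int[haar]_x _)%E in H.
have {H} J_le : (J <= (p * (M + e) / F * fine I)%:E)%E.
  apply: H => x; last by have := vF x; rewrite vE.
  by rewrite ME opprK.
have J0 : (0 <= J)%E by apply: integral_ge0 => x _; rewrite lee_fin powR_ge0.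
have JE : J = (fine J)%:E.
  by rewrite fineK// ge0_fin_numE// (le_lt_trans J_le)// ltry.
have my : measurable_fun [set: measurableTypeR R] (fun x => `|ftilde x / F| `^ p).
  have sy : derivable_bounded (fun x => ftilde x / F).
    by under eq_fun do rewrite mulrC; exact: derivable_boundedZ.
  apply: (measurableT_comp (measurable_powR p)).
  exact: (measurableT_comp (@normr_measurable R setT) (derivable_bounded_measurable sy)).
have -> : Lp_norm p ftilde `^ p = F `^ p * fine J.
  rewrite Lp_norm_powR// -[RHS]/(fine ((F `^ p * fine J)%:E)) EFinM -JE.
  rewrite /J -ge0_integralZl_EFin ?powR_ge0//; first last.
  - by rewrite vE in my; exact/measurable_EFinP.
  congr fine; apply: eq_integral => x _; rewrite -EFinM -powRM ?(ltW F0)//.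
  by rewrite vE normrM normfV (gtr0_norm F0) mulrCA mulfV ?mulr1// gt_eqF.
move: J_le; rewrite JE lee_fin => J_le.
apply: le_trans (ler_wpM2l (powR_ge0 _ _) J_le) _.
(* One factor [F] cancels the [1 / F] of the bound, which leaves the exponent [p - 1]. *)
have -> : F `^ p = F `^ (p - 1) * F.
  by rewrite -[X in _ * X]powRr1 ?(ltW F0)// -powRD ?subrK// (gt_eqF F0) implybT.
rewrite -/F AE.
rewrite le_eqVlt; apply/orP; left; apply/eqP; move: (F `^ _) => G.
by have F1 := lt0r_neq0 F0; clearbody F; field.
Qed.
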